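(* For every positive integer $r$ and all $p_0<1$, $\varepsilon>0$, and $K$, there exist a $\lambda>0$ and a constant $C$ such that the following holds. Let $V$ be a finite set and let $\mathcal H$ be a nonempty $r$-uniform hypergraph with vertex set $V$ and weight function $d:\mathcal H\to(0,\infty)$. Let $p\in(0,p_0]$ and let $R$ be the $p$-random subset of $V$ (each element of $V$ is included independently with probability $p$). Suppose that, for every $s\in\{1,\dots,r\}$, $$\Delta_s(\mathcal H)\le K\cdot(\lambda p)^{s-1}\cdot\frac{e(\mathcal H)}{v(\mathcal H)}.$$ Then, letting $X=e(\mathcal H[R])$, for every nonnegative real $\eta$, $$-\log\Pr\big(X\le\eta\,\mathbb E[X]\big)\ \ge\ (1-\varepsilon)\,\Phi_p^{\mathcal H}(\eta+\varepsilon)-C.$$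
   Context: A hypergraph $\mathcal H$ is identified with its set of edges (subsets of $V=V(\mathcal H)$); $v(\mathcal H)=|V|$; nonempty means having at least one edge. For a weighted hypergraph with weights $(d_A)_{A\in\mathcal H}$: $e(\mathcal H)=\sum_{A\in\mathcal H}d_A$; for $B\subseteq V$, $\deg_{\mathcal H}B=\sum_{A\in\mathcal H,\,B\subseteq A}d_A$; $\Delta_s(\mathcal H)=\max\{\deg_{\mathcal H}B: B\subseteq V,\ |B|=s\}$; for $W\subseteq V$, $\mathcal H[W]$ is the hypergraph with vertex set $W$ and edges $\{A\in\mathcal H:A\subseteq W\}$ (with the same weights), so $e(\mathcal H[W])=\sum_{A\in\mathcal H,\,A\subseteq W}d_A$. For $q:V\to[0,1]$, $R^{(q)}$ is the random subset of $V$ including each $v$ independently with probability $q_v$. With natural logarithms and $0\log0=0$, $$i_p(q)=q\log\frac qp+(1-q)\log\frac{1-q}{1-p},$$ and $$\Phi_p^{\mathcal H}(\eta)=\min\Big\{\sum_{v\in V}i_p(q_v):\ q\in[0,1]^V,\ \mathbb E\big[e(\mathcal H[R^{(q)}])\big]\le\eta\cdot\mathbb E\big[e(\mathcal H[R])\big]\Big\}.$$ (The sum $\sum_v i_p(q_v)$ is the Kullback–Leibler divergence of the law of independent $\mathrm{Ber}(q_v)$ variables from that of i.i.d. $\mathrm{Ber}(p)$ variables indexed by $V$.) *)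

(* Defs.v *)
From HB Require Import structures.
From mathcomp Require Import all_boot all_order all_algebra.
From mathcomp Require Import all_classical all_reals all_analysis.

Set Implicit Arguments.
Unset Strict Implicit.
Unset Printing Implicit Defensive.

Import Order.TTheory GRing.Theory Num.Theory.
Import numFieldNormedType.Exports.

Local Open Scope classical_set_scope.
Local Open Scope ring_scope.

(* A hypergraph on the vertex set [V] is its set of edges [H : {set {set V}}].
   The weights are a function [d : {set V} -> R] of which only the values on
   the edges of [H] matter. *)
Section WeightedHypergraph.
Variables (R : realType) (V : finType).
Implicit Types (H : {set {set V}}) (d : {set V} -> R).

Definition uniform_hypergraph (r : nat) H : Prop :=
  forall A : {set V}, A \in H -> #|A| = r.

Definition edge_weight H d : R := \sum_(A in H) d A.

Definition wdeg H d (B : {set V}) : R := \sum_(A in H | B \subset A) d A.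

(* The degrees are nonnegative for positive weights, so that the default
   value 0 of the iterated maximum is harmless. *)
Definition max_wdeg (s : nat) H d : R :=
  \big[Num.max/0]_(B : {set V} | #|B| == s) wdeg H d B.

Definition induced_hypergraph H (W : {set V}) : {set {set V}} :=
  [set A in H | A \subset W]%SET.

End WeightedHypergraph.

Section RandomSubset.
Variables (R : realType) (V : finType).

(* The law of the random subset of [V] that includes each [v] independently
   with probability [q v]: the probability that it is equal to [W]. *)
Definition rset_mass (q : V -> R) (W : {set V}) : R :=
  (\prod_(v in W) q v) * (\prod_(v in ~: W) (1 - q v)).

Definition rset_prob (q : V -> R) (E : pred {set V}) : R :=
  \sum_(W : {set V} | E W) rset_mass q W.

Definition rset_expect (q : V -> R) (f : {set V} -> R) : R :=
  \sum_(W : {set V}) rset_mass q W * f W.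

End RandomSubset.

Section RateFunction.
Variables (R : realType) (V : finType).

(* As [ln 0 = 0], the convention 0 log 0 = 0 holds for q = 0 and q = 1. *)
Definition bernoulli_KL (p q : R) : R :=
  q * ln (q / p) + (1 - q) * ln ((1 - q) / (1 - p)).

Definition Phi_feasible (H : {set {set V}}) (d : {set V} -> R) (p eta : R) :
    set (V -> R) :=
  [set q | (forall v, 0 <= q v <= 1) /\
    rset_expect q (fun W => edge_weight (induced_hypergraph H W) d) <=
      eta * rset_expect (fun=> p)
              (fun W => edge_weight (induced_hypergraph H W) d)].

(* This infimum is a minimum: see [Phi_feasible_neq0] and [PhiP]. *)
Definition Phi (H : {set {set V}}) (d : {set V} -> R) (p eta : R) : R :=
  inf [set \sum_(v : V) bernoulli_KL p (q v) | q in Phi_feasible H d p eta].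

End RateFunction.

Section PhiMin.
Variable R : realType.

Lemma xlnx_bound (x : R) : `|x| < 1 -> `|x * ln x| <= 2 * Num.sqrt `|x|.
Proof.
move=> x1; have [x0|x0] := leP x 0.
  by rewrite ln0// mulr0 normr0 mulr_ge0// sqrtr_ge0.
rewrite (gtr0_norm x0) in x1 *.
have sx0 : 0 < Num.sqrt x by rewrite sqrtr_gt0.
have sxx : x = Num.sqrt x * Num.sqrt x by rewrite -expr2 sqr_sqrtr// ltW.
set y := Num.sqrt x in sx0 sxx *.
have lnx : ln x = 2 * ln y by rewrite sxx lnM// mulr_natl mulr2n.
have lnx0 : ln x <= 0 by rewrite ln_le0// ltW.
rewrite normrM (gtr0_norm x0) (ler0_norm lnx0) lnx.
have : ln y^-1 < y^-1 by rewrite ln_sublinear// invr_gt0.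
rewrite lnV ?posrE// => h.
rewrite -mulrN mulrCA ler_pM2l// {1}sxx -mulrA.
rewrite -[leRHS]mulr1 ler_pM2l//.
by rewrite -(mulfV (lt0r_neq0 sx0)) ler_pM2l// ltW.
Qed.

Lemma continuous_xlnx : continuous (fun x : R => x * ln x).
Proof.
move=> x; have [x0|x0|->] := ltgtP x 0.
- rewrite /continuous_at ln0 ?ltW// mulr0.
  apply: cvg_near_cst; near=> y; rewrite ln0 ?mulr0//.
  by apply/ltW; near: y; exact: lt_nbhsl.
- by apply: cvgM; [exact: cvg_id | exact: continuous_ln].
- rewrite /continuous_at mul0r; apply/norm_cvg0P.
  have xlnx_near : \forall y \near (0 : R),
      cst 0 y <= `|y * ln y| <= 2 * Num.sqrt `|y|.
    have : \forall y \near (0 : R), `|y| < 1 by exact: nbhs0_lt.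
    by apply: filterS => y y1; rewrite normr_ge0 xlnx_bound.
  apply: (squeeze_cvgr xlnx_near).
  + exact: cvg_cst.
  + rewrite -[X in _ --> X](mulr0 2); apply: cvgM; first exact: cvg_cst.
    rewrite -[X in _ --> X](@sqrtr0 R) -[X in Num.sqrt X](@normr0 _ R).
    apply: (@continuous_comp _ _ _ (fun y : R => `|y|) Num.sqrt).
      exact: norm_continuous.
    exact: sqrt_continuous.
Unshelve. all: by end_near. Qed.

Lemma continuous_bernoulli_KL (p : R) : 0 < p < 1 ->
  continuous (bernoulli_KL p).
Proof.
move=> /andP[p0 p1] x.
have p1' : 1 - p != 0 by rewrite subr_eq0 gt_eqF.
have -> : bernoulli_KL p = (fun x => p * ((x / p) * ln (x / p)) +
    (1 - p) * (((1 - x) / (1 - p)) * ln ((1 - x) / (1 - p)))).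
  apply/funext => y; rewrite /bernoulli_KL !mulrA.
  by rewrite [p * y]mulrC [(1 - p) * (1 - y)]mulrC !mulfK// gt_eqF.
have xlnx_comp (f : R -> R) : {for x, continuous f} ->
    f y * ln (f y) @[y --> x] --> f x * ln (f x).
  move=> fx; apply: (@continuous_comp _ _ _ f (fun y => y * ln y)) => //.
  exact: continuous_xlnx.
apply: cvgD; (apply: cvgM; first exact: cvg_cst); apply: xlnx_comp.
- by apply: cvgM; [exact: cvg_id | exact: cvg_cst].
- apply: cvgM; last exact: cvg_cst.
  by apply: cvgB; [exact: cvg_cst | exact: cvg_id].
Qed.

Lemma continuous_sumr (T : topologicalType) (I : finType) (P : pred I)
    (f : I -> T -> R) :
  (forall i, continuous (f i)) -> continuous (fun x => \sum_(i | P i) f i x).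
Proof.
move=> fc; apply: (@continuous_big R I +%R 0 P) => [|i _].
  exact: add_continuous.
exact: fc.
Qed.

Lemma continuous_prodr (T : topologicalType) (I : finType) (P : pred I)
    (f : I -> T -> R) :
  (forall i, continuous (f i)) -> continuous (fun x => \prod_(i | P i) f i x).
Proof.
move=> fc; apply: (@continuous_big R I *%R 1 P) => [|i _].
  exact: mul_continuous.
exact: fc.
Qed.

Lemma continuous_rset_expect (V : finType) (T : topologicalType)
    (q : V -> T -> R) (f : {set V} -> R) :
  (forall v, continuous (q v)) ->
  continuous (fun x => rset_expect (fun v => q v x) f).
Proof.
move=> qc.
apply: (@continuous_sumr T _ predT
  (fun W x => rset_mass (fun v => q v x) W * f W)) => W x.
apply: cvgM; last exact: cvg_cst.
apply: cvgM.
  exact: (@continuous_prodr T V (fun v => v \in W) q qc x).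
apply: (@continuous_prodr T V (fun v => v \in (~: W)%SET)
  (fun v x => 1 - q v x)) => v y.
by apply: cvgB; [exact: cvg_cst | exact: qc].
Qed.

Lemma continuous_KL_sum (V : finType) (T : topologicalType)
    (q : V -> T -> R) (p : R) : 0 < p < 1 ->
  (forall v, continuous (q v)) ->
  continuous (fun x => \sum_(v : V) bernoulli_KL p (q v x)).
Proof.
move=> p01 qc; apply: (@continuous_sumr T V predT
  (fun v x => bernoulli_KL p (q v x))) => v x.
apply: (@continuous_comp _ _ _ (q v) (bernoulli_KL p)); first exact: qc.
exact: continuous_bernoulli_KL.
Qed.

Lemma Phi_feasible_neq0 (V : finType) (H : {set {set V}})
    (d : {set V} -> R) (p eta : R) :
  finset.set0 \notin H -> (forall A, A \in H -> 0 < d A) ->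
  0 <= p <= 1 -> 0 <= eta -> Phi_feasible H d p eta !=set0.
Proof.
move=> H0 d0 /andP[p0 p1] eta0; exists (fun=> 0).
split=> [v|]; first by rewrite lexx ler01.
rewrite [leLHS]big1 => [|W _].
  rewrite mulr_ge0// sumr_ge0// => W _; rewrite mulr_ge0//.
    by rewrite mulr_ge0//; apply: prodr_ge0 => v _ //; rewrite subr_ge0.
  by apply: sumr_ge0 => A; rewrite inE => /andP[/d0/ltW].
have [->|[v vW]] := set_0Vmem W.
  rewrite [edge_weight _ _]big1 ?mulr0// => A; rewrite inE finset.subset0.
  by move=> /andP[AH /eqP A0]; rewrite A0 (negbTE H0) in AH.
by rewrite /rset_mass (bigD1 v)//= !mul0r.
Qed.

Lemma PhiP (V : finType) (H : {set {set V}}) (d : {set V} -> R) (p eta : R) :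
  0 < p < 1 -> Phi_feasible H d p eta !=set0 ->
  exists2 q, Phi_feasible H d p eta q &
    Phi H d p eta = \sum_(v : V) bernoulli_KL p (q v) /\
    (forall q', Phi_feasible H d p eta q' ->
      Phi H d p eta <= \sum_(v : V) bernoulli_KL p (q' v)).
Proof.
move=> p01 F0; pose T := prod_topology (fun _ : V => R).
pose cost (q : T) := \sum_(v : V) bernoulli_KL p (q v).
pose F : set T := Phi_feasible H d p eta.
have projc v : continuous (fun q : T => q v).
  exact: (@proj_continuous _ (fun _ : V => R) v).
have continuous_expect f := @continuous_rset_expect V T _ f projc.
have continuous_cost := @continuous_KL_sum V T _ p p01 projc.
have compactF : compact F.
  apply: compact_closedI.
    have := @tychonoff V (fun=> R) (fun=> `[0, 1]%classic)
      (fun=> @segment_compact R 0 1).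
    by congr compact; apply/seteqP; split => q /= + v => /(_ v);
      rewrite in_itv.
  exact: (preimage_closed (fun q _ => continuous_expect _ q) (@closed_le _ _)).
have [q /set_mem Fq qmin] := @compact_EVT_min T R cost F F0 compactF
  (continuous_subspaceT continuous_cost).
have Phi_le q' : F q' -> Phi H d p eta <= cost q'.
  move=> Fq'; apply: ge_inf; last by exists q'.
  by exists (cost q) => _ [q'' Fq'' <-]; exact/qmin/mem_set.
exists q => //; split => //; apply/eqP; rewrite eq_le Phi_le//=.
apply: lb_le_inf; first by exists (cost q); exists q.
by move=> _ [q' Fq' <-]; exact/qmin/mem_set.
Qed.

End PhiMin.

(* Main.v *)
Require Import Defs.
From mathcomp Require Import all_boot all_order all_algebra.
From mathcomp Require Import all_classical all_reals all_analysis.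
From mathcomp Require Import ring lra zify.

Import Order.TTheory GRing.Theory Num.Theory.

Local Open Scope ring_scope.

(** Let Y be the p-random set conditioned on the lower tail event D, which is
    closed under removing vertices. Then -log Pr(D) is the relative entropy of
    Y with respect to the p-random set, and the aim is to bound it from below
    by the relative entropy of a product measure that is admissible for Phi.

    The product measures come from conditioning on Y inside a set W: the
    vertices of W get the density p, at no cost, and every other v gets its
    conditional probability q_v given the trace of Y on W. For every W the
    entropy of Y is at least the expectation of sum_v i_p(q_v)
    ([sum_bernoulli_KL_le_entropy]). So it suffices to find one W such that,
    with probability at least 1 - eps over the trace, this product measure has
    at most (eta + eps) E[X] expected edges.

    Edges that meet W contribute little as soon as |W| <= eps |V| / (2K). For
    the others one has to compare the products of the q_a with the indicators
    that the edge lies in Y, because X(Y) <= eta E[X] always holds. The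
    obstacle is that these products need accuracy of order p^r. Two facts make
    this possible.

    - As D is decreasing, Y is dominated by the p-random set, even after
      conditioning on a trace: q_v <= p, and Y contains a set B with
      probability at most p^|B|. Hence the energy, the sum over v of
      E[q_v^2] (for v in W, given the trace on the rest of W), is at most
      p^2 |V|. Choosing W to maximise the energy minus a multiple of |W| yields
      a small W such that the q_v move little, in mean square and on the scale
      p, when any further small set S is revealed ([exists_saturated_set]).

    - Telescoping writes the error as a sum over v of E[(q_v - Y_v) F_v], where
      F_v is a weighted count of the links of v inside Y. The count F_v
      depends on all of Y, but averaging over a random set S of small density
      lambda replaces it by the rescaled count of the links contained in S.
      That count is a function of the trace on W and S, so Y_v may be replaced
      by its conditional probability given this trace, which is close to q_v by
      the choice of W. The Cauchy-Schwarz inequality then asks for the second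
      moment of the sampled count: two links that share i vertices cost
      (lambda p)^(-i), which is precisely what the bounds on the maximum
      degrees pay for ([sampled_link_second_moment], [mean_field_error]).

    Markov's inequality turns the resulting bound on the mean error into a
    bound on the probability of a bad trace ([entropy_ge_Phi]); the constant C
    can be taken to be 0. *)

(** * Product measures on subsets *)

Section ProductMeasure.
Local Set Implicit Arguments.
Local Unset Strict Implicit.
Import mathcomp.boot.fintype mathcomp.boot.finset.
Context {R : realType} {V : finType}.
Implicit Types (q : V -> R) (W Y Z B : {set V}) (v : V).

Lemma rset_massE q Y :
  rset_mass q Y = \prod_v (if v \in Y then q v else 1 - q v).
Proof.
rewrite /rset_mass [RHS](bigID (mem Y)) /=; congr (_ * _).
  by apply: eq_bigr => v ->.
by apply: eq_big => [v|v]; rewrite in_setC // => /negbTE ->.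
Qed.

Lemma rset_mass_ge0 q Y : (forall v, 0 <= q v <= 1) -> 0 <= rset_mass q Y.
Proof.
move=> q01; rewrite rset_massE prodr_ge0// => v _.
by case: ifP => _; have /andP[? ?] := q01 v; rewrite ?subr_ge0.
Qed.

(** The sum factorises over the vertices: those outside [W] contribute
    [q v + (1 - q v) = 1]. *)
Lemma rset_sum_agree q W Z :
  \sum_(Y : {set V} | Y :&: W == Z :&: W) rset_mass q Y =
  \prod_(v in W) (if v \in Z then q v else 1 - q v).
Proof.
pose F v := if (v \in W) && (v \notin Z) then 0 else q v.
pose G v := if (v \in W) && (v \in Z) then 0 else 1 - q v.
transitivity (\sum_(Y : {set V}) \prod_v (if v \in Y then F v else G v)).
  rewrite big_mkcond /=; apply: eq_bigr => Y _.
  case: ifP => [/eqP YZ|/negbT YZ].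
    rewrite rset_massE; apply: eq_bigr => v _; rewrite /F /G.
    have := congr1 (fun S : {set V} => v \in S) YZ; rewrite !inE.
    by case: (v \in Y); case: (v \in W); case: (v \in Z).
  have [v vW vYZ] : exists2 v, v \in W & (v \in Y) != (v \in Z).
    move: YZ; rewrite eqEsubset negb_and => /orP[] /subsetPn[v];
      rewrite !inE => /andP[vY vW]; rewrite vW andbT => vZ; exists v => //;
      by rewrite vY (negbTE vZ).
  rewrite (bigD1 v)//= /F /G vW /=.
  by move: vYZ; case: (v \in Y); case: (v \in Z) => //= _; rewrite mul0r.
rewrite -bigA_distr/= [LHS](bigID (mem W))/= [X in _ * X]big1 ?mulr1.
  apply: eq_bigr => v vW; rewrite /F /G vW /=.
  by case: (v \in Z); rewrite ?addr0 ?add0r.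
by move=> v /negbTE vW; rewrite /F /G vW /= addrC subrK.
Qed.

Lemma rset_mass_sum1 q : \sum_Y rset_mass q Y = 1.
Proof.
transitivity (\sum_(Y : {set V} | Y :&: set0 == set0 :&: set0) rset_mass q Y).
  by apply: eq_bigl => Y; rewrite !setI0 eqxx.
by rewrite rset_sum_agree big_set0.
Qed.

Lemma rset_prob_superset q B :
  rset_prob q (fun Y => B \subset Y) = \prod_(v in B) q v.
Proof.
transitivity (\sum_(Y : {set V} | Y :&: B == B :&: B) rset_mass q Y).
  by apply: eq_bigl => Y; rewrite setIid; apply/setIidPr/eqP.
by rewrite rset_sum_agree; apply: eq_bigr => v ->.
Qed.

Lemma rset_expect_edge_weight q (H : {set {set V}}) (d : {set V} -> R) :
  rset_expect q (fun W => edge_weight (induced_hypergraph H W) d) =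
  \sum_(A in H) d A * \prod_(v in A) q v.
Proof.
rewrite /rset_expect /edge_weight.
under eq_bigr => W _.
  rewrite mulr_sumr (eq_bigl (fun A => (A \in H) && (A \subset W))); last first.
    by move=> A; rewrite inE.
  rewrite big_mkcondr/=.
  over.
rewrite exchange_big/=; apply: eq_bigr => A _.
rewrite -rset_prob_superset /rset_prob mulr_sumr [RHS]big_mkcond/=.
by apply: eq_bigr => W _; case: ifP => // _; rewrite mulrC.
Qed.

Lemma rset_expect_card (l : R) :
  rset_expect (fun=> l) (fun Y => #|Y|%:R) = #|V|%:R * l.
Proof.
rewrite /rset_expect; under eq_bigr => Y _.
  rewrite -sum1_card natr_sum mulr_sumr big_mkcond/=; over.
rewrite exchange_big/= (eq_bigr (fun=> l)) => [|v _].
  by rewrite sumr_const mulr_natl.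
rewrite -big_mkcond/=.
transitivity (rset_prob (fun=> l) (fun Y : {set V} => [set v] \subset Y)).
  by apply: eq_big => [Y|Y _]; rewrite ?sub1set ?mulr1.
by rewrite rset_prob_superset big_set1.
Qed.

(** Removing [v] maps the sets of [E] that contain [v] injectively to sets of
    [E] that do not, and divides the mass by the odds [p / (1 - p)].
    Closure under removal of this one vertex persists when [E] also fixes the
    trace on a set avoiding [v]. *)
Lemma downset_mem_le (p : R) (E : pred {set V}) v :
  0 <= p <= 1 -> (forall Y, E Y -> E (Y :\ v)) ->
  \sum_(Y | E Y && (v \in Y)) rset_mass (fun=> p) Y <=
    p * \sum_(Y | E Y) rset_mass (fun=> p) Y.
Proof.
move=> p01 Ev.
have m0 Y : 0 <= rset_mass (fun=> p) Y by exact: rset_mass_ge0.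
have mD Y : v \in Y ->
    (1 - p) * rset_mass (fun=> p) Y = p * rset_mass (fun=> p) (Y :\ v).
  move=> vY; rewrite !rset_massE (bigD1 v)//= vY [in RHS](bigD1 v)//= !inE.
  rewrite eqxx/= mulrCA; congr (_ * (_ * _)).
  by apply: eq_bigr => w wv; rewrite !inE wv.
set S := \sum_(Y | E Y) _.
have SE : S = \sum_(Y | E Y && (v \in Y)) rset_mass (fun=> p) Y +
    \sum_(Y | E Y && (v \notin Y)) rset_mass (fun=> p) Y.
  by rewrite /S (bigID (fun Y : {set V} => v \in Y)).
have le : (1 - p) * \sum_(Y | E Y && (v \in Y)) rset_mass (fun=> p) Y <=
    p * \sum_(Y | E Y && (v \notin Y)) rset_mass (fun=> p) Y.
  rewrite mulr_sumr (eq_bigr (fun Y => p * rset_mass (fun=> p) (Y :\ v)));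
    last by move=> Y /andP[_ /mD].
  rewrite -mulr_sumr ler_wpM2l//; first by case/andP: p01.
  rewrite (reindex_onto (fun Y => v |: Y) (fun Y => Y :\ v)) /=; last first.
    by move=> Y /andP[_ vY]; rewrite setD1K.
  rewrite big_mkcond [leRHS]big_mkcond/=; apply: ler_sum => Y _.
  case: ifP => [/andP[/andP[EY _] /eqP YE]|_]; last by case: ifP.
  have vY : v \notin Y by rewrite -YE !inE eqxx.
  by have := Ev _ EY; rewrite YE => ->; rewrite vY.
rewrite SE; move: le; rewrite mulrBl mul1r mulrDr; lra.
Qed.

End ProductMeasure.

(** * Conditioning on the trace of a random set *)

Section Conditioning.
Local Set Implicit Arguments.
Local Unset Strict Implicit.
Import mathcomp.boot.fintype mathcomp.boot.finset.
Context {R : realType} {V : finType}.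
Implicit Types (m : {set V} -> R) (W Y Z B : {set V}) (v : V).

Definition determined_by (T : Type) W (f : {set V} -> T) : Prop :=
  forall Y Z, Y :&: W = Z :&: W -> f Y = f Z.

(** The conditional probability that [v] belongs to an [m]-distributed set,
    given that it has the same trace as [Y] on [W] without [v]. Leaving [v] out
    keeps this probability at most [p] for every [v] once [m] comes from a
    decreasing event; conditioning on [v] itself would give 0 or 1. *)
Definition vertex_prob m W v Y : R :=
  (\sum_(Z | (Z :&: (W :\ v) == Y :&: (W :\ v)) && (v \in Z)) m Z) /
  (\sum_(Z | Z :&: (W :\ v) == Y :&: (W :\ v)) m Z).

Lemma determined_by_subset (T : Type) W W' (f : {set V} -> T) :
  W \subset W' -> determined_by W f -> determined_by W' f.
Proof.
move=> /setIidPr WW' fW Y Z YZ; apply: fW.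
by rewrite -WW' !setIA YZ.
Qed.

Lemma vertex_prob_determined m W v : determined_by (W :\ v) (vertex_prob m W v).
Proof. by move=> Y Z YZ; rewrite /vertex_prob YZ. Qed.

Lemma vertex_prob_ge0 m W v Y : (forall Z, 0 <= m Z) ->
  0 <= vertex_prob m W v Y.
Proof. by move=> m0; rewrite divr_ge0// sumr_ge0. Qed.

(** The defining property of a conditional expectation. Traces of zero mass,
    where the quotient is 0 / 0, contribute to neither side. *)
Lemma vertex_prob_tower m W v (g : {set V} -> R) : (forall Y, 0 <= m Y) ->
  determined_by (W :\ v) g ->
  \sum_Y m Y * (g Y * vertex_prob m W v Y) =
  \sum_Y m Y * (g Y * (v \in Y)%:R).
Proof.
move=> m0 gW; set S := W :\ v.
pose M Y := \sum_(Z : {set V} | Z :&: S == Y :&: S) m Z.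
transitivity (\sum_Y \sum_(Z : {set V} | (Z :&: S == Y :&: S) && (v \in Z))
    m Z * g Z / M Z * m Y).
  apply: eq_bigr => Y _; rewrite /vertex_prob -/S -/(M Y).
  rewrite mulr_suml !mulr_sumr; apply: eq_bigr => Z /andP[/eqP ZY _].
  by rewrite (gW Z Y ZY) /M ZY; ring.
rewrite (exchange_big_dep (fun Z => v \in Z))/=; last by move=> ? ? _ /andP[].
rewrite big_mkcond/=; apply: eq_bigr => Z _; case: ifP => vZ; last first.
  by rewrite !mulr0.
rewrite -mulr_sumr mulr1 (eq_bigl (fun Y => Y :&: S == Z :&: S)) -/(M Z).
  have [MZ0|MZ0] := eqVneq (M Z) 0; last by rewrite divfK.
  suff -> : m Z = 0 by rewrite !mul0r.
  by apply: (psumr_eq0P (fun Y _ => m0 Y) MZ0).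
by move=> Y; rewrite vZ andbT eq_sym.
Qed.

(** Pythagoras: the conditional probability given the coarser trace is an
    orthogonal projection of the one given the finer trace. *)
Lemma vertex_prob_energy_gap m W W' v : (forall Y, 0 <= m Y) -> W \subset W' ->
  \sum_Y m Y * (vertex_prob m W' v Y - vertex_prob m W v Y) ^+ 2 =
  \sum_Y m Y * vertex_prob m W' v Y ^+ 2 -
  \sum_Y m Y * vertex_prob m W v Y ^+ 2.
Proof.
move=> m0 WW'; set q := vertex_prob m W v; set q' := vertex_prob m W' v.
have qq' : \sum_Y m Y * (q Y * q' Y) = \sum_Y m Y * (q Y * q Y).
  rewrite !vertex_prob_tower//; first exact: vertex_prob_determined.
  exact: determined_by_subset (setSD _ WW') (@vertex_prob_determined m W v).
transitivity (\sum_Y m Y * q' Y ^+ 2 - \sum_Y m Y * q Y ^+ 2 +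
    2 * (\sum_Y m Y * (q Y * q Y) - \sum_Y m Y * (q Y * q' Y))).
  by rewrite -!sumrB mulr_sumr -big_split/=; apply: eq_bigr => Y _; ring.
by rewrite qq' subrr mulr0 addr0.
Qed.

End Conditioning.

(** * Domination under a decreasing event *)

Section ConditionedDownset.
Local Set Implicit Arguments.
Local Unset Strict Implicit.
Import mathcomp.boot.fintype mathcomp.boot.finset.
Context {R : realType} {V : finType}.
Variables (p : R) (D : pred {set V}).
Hypothesis p01 : 0 <= p <= 1.
Hypothesis downD : forall Y v, D Y -> D (Y :\ v).
Implicit Types (W Y Z B : {set V}) (v : V).

(** Conditioning on [D] without normalising, which spares divisions: the total
    mass is the probability of [D]. *)
Definition restricted_mass Y : R := (D Y)%:R * rset_mass (fun=> p) Y.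

Local Notation m := restricted_mass.

Lemma restricted_mass_ge0 Y : 0 <= m Y.
Proof. by rewrite mulr_ge0 ?ler0n// rset_mass_ge0. Qed.

Lemma restricted_massE (P : pred {set V}) :
  \sum_(Y | P Y) m Y = \sum_(Y | P Y && D Y) rset_mass (fun=> p) Y.
Proof.
rewrite big_mkcondr/=; apply: eq_bigr => Y _.
by rewrite /m; case: (D Y); rewrite ?mul1r ?mul0r.
Qed.

(** Harris' inequality for the increasing event of containing [B], by removing
    the vertices of [B] one at a time. *)
Lemma restricted_mass_superset B :
  \sum_(Y : {set V} | B \subset Y) m Y <= p ^+ #|B| * \sum_Y m Y.
Proof.
move: B => B; have [n] := ubnP #|B|; elim: n B => // n IHn B /ltnSE Bn.
have [->|[v vB]] := set_0Vmem B.
  by rewrite cards0 mul1r (eq_bigl predT)// => Y; rewrite sub0set.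
rewrite (cardsD1 v) vB add1n exprS -mulrA.
apply: (@le_trans _ _ (p * \sum_(Y : {set V} | B :\ v \subset Y) m Y));
  last first.
  case/andP: p01 => p0 _; rewrite ler_wpM2l//; apply: IHn.
  by move: Bn; rewrite (cardsD1 v) vB.
rewrite !restricted_massE.
rewrite (eq_bigl (fun Y => ((B :\ v \subset Y) && D Y) && (v \in Y))).
  apply: downset_mem_le => // Y /andP[BY DY]; rewrite downD// andbT.
  apply/subsetP => w wB; have := subsetP BY _ wB.
  by move: wB; rewrite !inE => /andP[-> _].
move=> Y; rewrite andbAC; congr (_ && _).
by rewrite -{1}(setD1K vB) subUset sub1set andbC.
Qed.

(** For a fixed trace on [W] without [v], the sets of [D] with this trace remain
    closed under removal of [v]. *)
Lemma vertex_prob_le W v Y : vertex_prob m W v Y <= p.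
Proof.
rewrite /vertex_prob; set M := \sum_(Z | _ == _) _.
have M0 : 0 <= M by apply: sumr_ge0 => Z _; exact: restricted_mass_ge0.
have [->|Mn0] := eqVneq M 0; first by rewrite invr0 mulr0; case/andP: p01.
rewrite ler_pdivrMr ?lt0r ?Mn0//= /M !restricted_massE.
rewrite (eq_bigl (fun Z => ((Z :&: (W :\ v) == Y :&: (W :\ v)) && D Z) &&
  (v \in Z))); last by move=> Z; rewrite andbAC.
apply: downset_mem_le => // Z /andP[/eqP ZY DZ]; rewrite downD// andbT -ZY.
apply/eqP/setP => w; rewrite !inE; case: eqP => //=.
by rewrite andbF.
Qed.

End ConditionedDownset.

(** * Logarithms and the Bernoulli divergence *)

Section Logarithm.
Context {R : realType}.

Lemma ln_prod (I : finType) (P : pred I) (f : I -> R) :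
  (forall i, P i -> 0 < f i) ->
  ln (\prod_(i | P i) f i) = \sum_(i | P i) ln (f i).
Proof.
move=> f0; suff [] : 0 < \prod_(i | P i) f i /\
  ln (\prod_(i | P i) f i) = \sum_(i | P i) ln (f i) by [].
elim/big_rec2: _ => [|i y x Pi [x0 xy]]; first by rewrite ln1.
by rewrite mulr_gt0 ?f0// lnM ?posrE ?f0// xy.
Qed.

Lemma ln_le_subr1 (x : R) : 0 < x -> ln x <= x - 1.
Proof.
by move=> x0; rewrite -{1}(subrKC 1 x) le_ln1Dx// ltrBrDl subrr.
Qed.

Lemma bernoulli_KL_ge0 (p x : R) : 0 < p < 1 -> 0 <= x <= 1 ->
  0 <= bernoulli_KL p x.
Proof.
move=> /andP[p0 p1] /andP[x0 x1]; rewrite /bernoulli_KL.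
(* The two instances, at [x, p] and at their complements, sum to zero. *)
have term (y s : R) : 0 <= y -> 0 < s -> y - s <= y * ln (y / s).
  rewrite le_eqVlt => /predU1P[<-|y0] s0; first by rewrite mul0r; lra.
  have -> : ln (y / s) = - ln (s / y).
    by rewrite -lnV ?posrE ?divr_gt0// invf_div.
  have := ln_le_subr1 (s / y) (divr_gt0 s0 y0).
  rewrite -(ler_pM2l y0) mulrBr mulrCA divff ?lt0r_neq0//; lra.
have := term x p x0 p0; have := term (1 - x) (1 - p).
rewrite !subr_ge0 !subr_gt0 => /(_ x1 p1); lra.
Qed.

Lemma bernoulli_KL_eq0 (p : R) : 0 < p < 1 -> bernoulli_KL p p = 0.
Proof.
move=> /andP[p0 p1]; rewrite /bernoulli_KL !divff ?ln1 ?mulr0 ?addr0//.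
  by rewrite subr_eq0 gt_eqF.
by rewrite gt_eqF.
Qed.

End Logarithm.

(** * Entropy and energy of the conditioned set *)

Section Entropy.
Local Set Implicit Arguments.
Local Unset Strict Implicit.
Import mathcomp.boot.fintype mathcomp.boot.finset.
Context {R : realType} {V : finType}.
Variables (p : R) (D : pred {set V}).
Hypothesis p01 : 0 < p < 1.
Hypothesis downD : forall Y v, D Y -> D (Y :\ v).
Implicit Types (W Y Z B : {set V}) (v : V).

Local Notation m := (restricted_mass p D).

Let p01' : 0 <= p <= 1.
Proof. by case/andP: p01 => p0 p1; rewrite !ltW. Qed.

Let m0 Y : 0 <= m Y.
Proof. exact: restricted_mass_ge0. Qed.

(** On [W] the density [p] costs no entropy, whatever the trace is; the edges
    meeting [W] are controlled by making [W] small. *)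
Definition mean_field W Y v : R :=
  if v \in W then p else vertex_prob m W v Y.

(** The product measure varies with the point [Y] at which it is evaluated, but
    only through the trace on [W], whose law is that of the [p]-random set.
    Hence these masses are the law of a random set: sample the trace first, then
    the rest independently. *)
Lemma sum_mean_field_mass W : \sum_Y rset_mass (mean_field W Y) Y = 1.
Proof.
rewrite -(rset_mass_sum1 (fun _ : V => p)).
rewrite (partition_big (fun Y => Y :&: W) predT)//=.
rewrite [RHS](partition_big (fun Y => Y :&: W) predT)//=.
apply: eq_bigr => Z _.
have [ZW|ZW] := boolP (Z \subset W); last first.
  by rewrite !big_pred0// => Y; apply: contraNF ZW => /eqP <-; exact: subsetIr.
rewrite -{1 2}(setIidPl ZW).
transitivity (\sum_(Y : {set V} | Y :&: W == Z :&: W)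
    rset_mass (mean_field W Z) Y).
  apply: eq_bigr => Y /eqP YZ; congr (rset_mass _ _).
  apply/funext => v; rewrite /mean_field; case: ifP => // vW.
  have WE : W :\ v = W by apply/setDidPl; rewrite disjoint_sym disjoints1 vW.
  by apply: vertex_prob_determined; rewrite WE.
by rewrite !rset_sum_agree; apply: eq_bigr => v vW; rewrite /mean_field vW.
Qed.

Lemma vertex_prob_gt0 W v Y : 0 < m Y -> v \in Y -> 0 < vertex_prob m W v Y.
Proof.
move=> mY vY; rewrite /vertex_prob divr_gt0//; rewrite (bigD1 Y) ?eqxx ?vY//=;
  by rewrite ltr_wpDr// sumr_ge0.
Qed.

(** Superadditivity of relative entropy with respect to a product measure. It is
    obtained as an instance of the Gibbs inequality: [g] below is the density,
    with respect to the [p]-random set, of the law sampled by trace and then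
    independently, the mean of its logarithm is the left-hand side by the tower
    property, and the inequality ln x <= x - 1 at [x = Z * g Y] compares it with
    the conditioned law, whose density is constant equal to [1 / Z] on [D]. *)
Lemma sum_bernoulli_KL_le_entropy W : 0 < \sum_Y m Y ->
  \sum_Y m Y * \sum_v bernoulli_KL p (mean_field W Y v) <=
    (\sum_Y m Y) * - ln (\sum_Y m Y).
Proof.
set Z := \sum_Y m Y => Z0; have /andP[p0 p1] := p01.
pose q := vertex_prob m W.
pose r Y v := if v \in Y then q v Y / p else (1 - q v Y) / (1 - p).
have qp v Y : q v Y <= p by exact: vertex_prob_le.
have tower v : v \notin W -> \sum_Y m Y * bernoulli_KL p (q v Y) =
    \sum_Y m Y * ln (r Y v).
  move=> vW; have WE : W :\ v = W.
    by apply/setDidPl; rewrite disjoint_sym disjoints1.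
  pose a Y := ln (q v Y / p) - ln ((1 - q v Y) / (1 - p)).
  have qW : determined_by (W :\ v) (q v) by exact: vertex_prob_determined.
  have aW : determined_by (W :\ v) a by move=> Y X YX; rewrite /a (qW _ _ YX).
  have := vertex_prob_tower m0 aW.
  rewrite -/(q v) => /(congr1
    (fun x => x + \sum_Y m Y * ln ((1 - q v Y) / (1 - p)))).
  rewrite -!big_split/= => towerE.
  transitivity (\sum_i (m i * (a i * q v i) +
      m i * ln ((1 - q v i) / (1 - p)))).
    by apply: eq_bigr => Y _; rewrite /bernoulli_KL /a; ring.
  rewrite towerE; apply: eq_bigr => Y _; rewrite /a /r.
  by case: (v \in Y) => /=; ring.
have -> : \sum_Y m Y * (\sum_v bernoulli_KL p (mean_field W Y v)) =
    \sum_Y m Y * (\sum_(v | v \notin W) ln (r Y v)).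
  transitivity (\sum_Y m Y * (\sum_(v | v \notin W) bernoulli_KL p (q v Y))).
    apply: eq_bigr => Y _; congr (_ * _); rewrite (bigID (mem W))/= big1 ?add0r.
      by apply: eq_bigr => v /negbTE vW; rewrite /mean_field vW.
    by move=> v vW; rewrite /mean_field vW bernoulli_KL_eq0.
  under eq_bigr do rewrite mulr_sumr; rewrite exchange_big/=.
  under [RHS]eq_bigr do rewrite mulr_sumr; rewrite [RHS]exchange_big/=.
  by apply: eq_bigr => v vW; exact: tower.
pose g Y := \prod_(v | v \notin W) r Y v.
have massg Y : rset_mass (fun=> p) Y * g Y = rset_mass (mean_field W Y) Y.
  rewrite !rset_massE [in LHS](bigID (mem W))/= -mulrA -big_split/=.
  rewrite [RHS](bigID (mem W))/=; congr (_ * _); apply: eq_bigr => v vW.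
    by rewrite /mean_field vW.
  rewrite /mean_field (negbTE vW) /r; case: (v \in Y);
    by rewrite mulrC divfK// ?lt0r_neq0// subr_gt0.
have mass0 Y : 0 <= rset_mass (mean_field W Y) Y.
  apply: rset_mass_ge0 => v; rewrite /mean_field; case: ifP => // _.
  by rewrite vertex_prob_ge0//= (le_trans (qp v Y))// ltW.
have pointwise Y : m Y * (\sum_(v | v \notin W) ln (r Y v)) <=
    m Y * (Z * g Y - 1 - ln Z).
  have := m0 Y; rewrite le_eqVlt => /predU1P[<-|mY]; first by rewrite !mul0r.
  rewrite ler_pM2l//.
  have r0 v : 0 < r Y v.
    rewrite /r; case: ifP => vY; first by rewrite divr_gt0// vertex_prob_gt0.
    by rewrite divr_gt0// subr_gt0// (le_lt_trans (qp v Y)).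
  have g0 : 0 < g Y by exact: prodr_gt0.
  have := ln_le_subr1 (Z * g Y) (mulr_gt0 Z0 g0).
  by rewrite lnM ?posrE// ln_prod//; lra.
apply: (le_trans (ler_sum _ (fun Y _ => pointwise Y))).
have gle1 : \sum_Y m Y * g Y <= 1.
  rewrite -(sum_mean_field_mass W); apply: ler_sum => Y _.
  rewrite /restricted_mass -mulrA massg.
  by case: (D Y); rewrite ?mul1r ?mul0r.
have -> : \sum_Y m Y * (Z * g Y - 1 - ln Z) =
    Z * \sum_Y m Y * g Y - Z - Z * ln Z.
  rewrite mulr_sumr {4 5}/Z mulr_suml -!sumrB.
  by apply: eq_bigr => Y _; ring.
have := ler_wpM2l (ltW Z0) gle1; lra.
Qed.

(** Revealing more vertices can only increase the energy, which is at most
    [p ^+ 2 * Z] per vertex. A set [W] maximising the energy with a penalty [c]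
    per revealed vertex is small, by comparison with the empty set, and
    enlarging it by [S] gains at most [c * #|S|]; by Pythagoras this gain is the
    mean square change of the conditional probabilities. *)
Lemma exists_saturated_set (c : R) : 0 <= c -> exists W : {set V},
  c * #|W|%:R <= #|V|%:R * (p ^+ 2 * \sum_Y m Y) /\
  forall S : {set V},
    \sum_v \sum_Y m Y *
      (vertex_prob m (W :|: S) v Y - vertex_prob m W v Y) ^+ 2 <= c * #|S|%:R.
Proof.
move=> c0.
pose G W := \sum_v \sum_Y m Y * vertex_prob m W v Y ^+ 2.
have G0 W : 0 <= G W.
  by do 2!(apply: sumr_ge0 => ? _); rewrite mulr_ge0// sqr_ge0.
have GV W : G W <= #|V|%:R * (p ^+ 2 * \sum_Y m Y).
  rewrite mulr_natl -sumr_const; apply: ler_sum => v _.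
  rewrite mulr_sumr; apply: ler_sum => Y _; rewrite mulrC ler_wpM2r//.
  have := vertex_prob_ge0 W v Y m0.
  have := vertex_prob_le p01' downD W v Y => qp q0.
  by rewrite ler_pXn2r// ?nnegrE// (le_trans q0).
have [W _ Wmax] := @arg_maxP _ _ _ set0 xpredT (fun W => G W - c * #|W|%:R) isT.
exists W; split=> [|S].
  have := Wmax set0 isT; have := G0 set0; have := GV W.
  by rewrite cards0 mulr0/=; lra.
have := Wmax (W :|: S) isT => /=.
have : c * #|W :|: S|%:R <= c * #|W|%:R + c * #|S|%:R.
  by rewrite -mulrDr ler_wpM2l// -natrD ler_nat cardsU leq_subr.
suff -> : \sum_v \sum_Y m Y *
    (vertex_prob m (W :|: S) v Y - vertex_prob m W v Y) ^+ 2 =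
    G (W :|: S) - G W by lra.
rewrite /G -sumrB; apply: eq_bigr => v _.
by rewrite vertex_prob_energy_gap// subsetUl.
Qed.

End Entropy.

(** * Interpolating between two products *)

Section Hybrid.
Local Set Implicit Arguments.
Local Unset Strict Implicit.
Import mathcomp.boot.fintype mathcomp.boot.finset.
Context {R : realType} {V : finType}.
Implicit Types (W Y Z A B S T : {set V}) (v : V) (q : V -> R).

(** The vertices before [v] in the enumeration order are already replaced by
    their indicators, those from [v] on still carry their densities. *)
Definition hybrid q Y v (a : V) : R :=
  if (enum_rank a < enum_rank v)%N then (a \in Y)%:R else q a.

Lemma hybrid_telescope q Y A :
  \prod_(a in A) q a - \prod_(a in A) (a \in Y)%:R =
  \sum_(v in A) (q v - (v \in Y)%:R) * \prod_(a in A :\ v) hybrid q Y v a.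
Proof.
pose f k : R :=
  \prod_(a in A) if (enum_rank a < k)%N then (a \in Y)%:R else q a.
have f0 : f 0%N = \prod_(a in A) q a by apply: eq_bigr.
have fn : f #|V| = \prod_(a in A) (a \in Y)%:R.
  by rewrite /f; apply: eq_bigr => a _; rewrite ltn_ord.
rewrite -f0 -fn; transitivity (\sum_(0 <= k < #|V|) (f k - f k.+1)).
  rewrite -[LHS]opprB -(@telescope_sumr _ 0 #|V| f)// -sumrN.
  by apply: eq_bigr => k _; rewrite opprB.
rewrite big_mkord (reindex_onto (@enum_rank V) enum_val) /=; last first.
  by move=> k _; exact: enum_valK.
rewrite (eq_bigl predT) => [|v]; last by rewrite enum_rankK eqxx.
rewrite (bigID (mem A))/= [X in _ + X]big1 ?addr0 => [|v vA].
  apply: eq_bigr => v vA; rewrite /f (bigD1 v)//= [X in _ - X](bigD1 v)//=.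
  rewrite ltnn ltnSn.
  have pE (F : V -> R) : \prod_(i in A | i != v) F i =
      \prod_(i in A :\ v) F i.
    by apply: eq_bigl => i; rewrite !inE andbC.
  rewrite !pE [RHS]mulrBl; congr (_ * _ - _ * _).
  apply: eq_bigr => a; rewrite !inE => /andP[av _].
  rewrite /hybrid ltnS leq_eqVlt; case: eqP => // /val_inj/enum_rank_inj ae.
  by rewrite ae eqxx in av.
rewrite /f -[X in X - _]/(f _); apply/eqP; rewrite subr_eq0; apply/eqP.
apply: eq_bigr => a aA; rewrite [in RHS]ltnS [in RHS]leq_eqVlt.
case: eqP => // /val_inj/enum_rank_inj ae.
by rewrite -ae aA in vA.
Qed.

Lemma hybrid_01 q Y v a : (forall b, 0 <= q b <= 1) -> 0 <= hybrid q Y v a <= 1.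
Proof.
move=> q01; rewrite /hybrid; case: ifP => // _.
by case: (a \in Y); rewrite ?lexx ?ler01.
Qed.

Lemma prod_mul_le_union (h : V -> R) A B : (forall a, 0 <= h a <= 1) ->
  (\prod_(a in A) h a) * (\prod_(a in B) h a) <= \prod_(a in A :|: B) h a.
Proof.
move=> h01.
have h0 a : 0 <= h a by case/andP: (h01 a).
have h1 a : h a <= 1 by case/andP: (h01 a).
rewrite big_mkcond [X in _ * X]big_mkcond [leRHS]big_mkcond -big_split/=.
apply: ler_prod => a _; rewrite inE.
case: (a \in A); case: (a \in B);
  rewrite /= ?mulr1 ?mul1r ?h0 ?lexx ?ler01 ?mulr_ge0//=.
by rewrite ler_piMr.
Qed.

(** The densities are bounded pointwise and the indicators by domination, so
    that a product of hybrids behaves as for the [p]-random set, although its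
    densities depend on [Y]. *)
Lemma sum_hybrid_le (p : R) (D : pred {set V}) (q : {set V} -> V -> R) v T :
  0 <= p <= 1 -> (forall Y v, D Y -> D (Y :\ v)) ->
  (forall Y a, 0 <= q Y a <= p) ->
  \sum_Y restricted_mass p D Y * \prod_(a in T) hybrid (q Y) Y v a <=
    p ^+ #|T| * \sum_Y restricted_mass p D Y.
Proof.
move=> p01 downD q0p; have /andP[p0 p1] := p01.
pose L := [set a in T | (enum_rank a < enum_rank v)%N].
have LT : L \subset T by apply/subsetP => a; rewrite inE => /andP[].
have Llt a : a \in L -> (enum_rank a < enum_rank v)%N.
  by rewrite inE => /andP[].
have m0 Y : 0 <= restricted_mass p D Y by exact: restricted_mass_ge0.
have hle Y : \prod_(a in T) hybrid (q Y) Y v a <=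
    p ^+ #|T :\: L| * (L \subset Y)%:R.
  rewrite (bigID (mem L))/= mulrC.
  have -> : \prod_(a in T | a \in L) hybrid (q Y) Y v a = (L \subset Y)%:R.
    rewrite (eq_bigl (mem L)); last first.
      move=> a /=; have [/(subsetP LT) ->//|] := boolP (a \in L).
      by rewrite andbF.
    have [LY|/subsetPn[a aL aY]] := boolP (L \subset Y).
      by rewrite big1// => a aL; rewrite /hybrid (subsetP LY _ aL) Llt.
    by rewrite (bigD1 a)//= /hybrid (negbTE aY) Llt// mul0r.
  rewrite ler_wpM2r// -prodr_const (eq_bigl (mem (T :\: L))); last first.
    by move=> a; rewrite /= !inE andbC.
  apply: ler_prod => a; rewrite !inE /hybrid => /andP[+ aT].
  by rewrite aT /= => /negbTE ->.
apply: (le_trans (ler_sum _ (fun Y _ => ler_wpM2l (m0 Y) (hle Y)))).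
have -> : \sum_Y restricted_mass p D Y * (p ^+ #|T :\: L| * (L \subset Y)%:R) =
    p ^+ #|T :\: L| * \sum_(Y : {set V} | L \subset Y) restricted_mass p D Y.
  rewrite mulr_sumr [RHS]big_mkcond/=; apply: eq_bigr => Y _.
  by case: ifP => _; rewrite ?mulr1 ?mulr0// mulrC.
have -> : p ^+ #|T| = p ^+ #|T :\: L| * p ^+ #|L|.
  by rewrite -exprD -(cardsID L T) (setIidPr LT) addnC.
rewrite -mulrA ler_wpM2l ?exprn_ge0//; exact: restricted_mass_superset.
Qed.

End Hybrid.

(** * Counting pairs of edges through a vertex *)

Section Degrees.
Local Set Implicit Arguments.
Local Unset Strict Implicit.
Import mathcomp.boot.fintype mathcomp.boot.finset.
Context {R : realType} {V : finType}.
Variables (r : nat) (H : {set {set V}}) (d : {set V} -> R).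
Hypothesis Hr : uniform_hypergraph r H.
Hypothesis d0 : forall A, A \in H -> 0 < d A.
Implicit Types (A B I W : {set V}) (v : V).

Lemma wdeg_ge0 B : 0 <= wdeg H d B.
Proof. by apply: sumr_ge0 => A /andP[/d0/ltW]. Qed.

Lemma wdeg_le_max B : wdeg H d B <= max_wdeg #|B| H d.
Proof. exact: (le_bigmax_cond _ (fun B => wdeg H d B)). Qed.

Lemma weight_meeting_le W : \sum_(A in H | ~~ [disjoint A & W]) d A <=
  \sum_(v in W) wdeg H d [set v].
Proof.
rewrite /wdeg (exchange_big_dep (mem H))/=; last by move=> v A _ /andP[].
rewrite big_mkcondr/=; apply: ler_sum => A AH.
have dA := ltW (d0 AH).
case: ifP => [|_]; last by rewrite sumr_ge0.
rewrite -setI_eq0 => /set0Pn[v /setIP[vA vW]].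
by rewrite (bigD1 v)/= ?vW ?AH ?sub1set ?vA// lerDl sumr_ge0.
Qed.

(** Sort the edges [B] by their intersection [I] with [A]. A pair meeting in [I]
    has [2r - 1 - #|I|] vertices besides [v], and the bound on the degree of [I]
    supplies [#|I| - 1] more powers of [x]: each of the at most [2 ^ r] choices
    of [I] contributes the same amount as disjoint links. *)
Lemma sum_edge_pairs_le (x M : R) v : 0 <= x -> (0 < r)%N ->
  (forall I : {set V}, v \in I -> (#|I| <= r)%N ->
     wdeg H d I <= x ^+ (#|I| - 1) * M) ->
  \sum_(A in H | v \in A) \sum_(B in H | v \in B)
    d A * d B * x ^+ #|(A :|: B) :\ v| <= 2 ^+ r * (x ^+ (r - 1)) ^+ 2 * M ^+ 2.
Proof.
move=> x0 r0 degM.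
have M0 : 0 <= M.
  have := degM [set v]; rewrite set11 cards1 => /(_ isT r0).
  by rewrite subnn mul1r; exact: le_trans (wdeg_ge0 _).
have inner A : A \in H -> v \in A ->
    \sum_(B in H | v \in B) d B * x ^+ #|(A :|: B) :\ v| <=
      2 ^+ r * ((x ^+ (r - 1)) ^+ 2 * M).
  move=> AH vA.
  rewrite (partition_big (fun B => A :&: B) (mem (powerset A)))/=; last first.
    by move=> B _; rewrite powersetE subsetIl.
  apply: (@le_trans _ _ (\sum_(I in powerset A) (x ^+ (r - 1)) ^+ 2 * M));
    last first.
    by rewrite sumr_const card_powerset (Hr AH) -[leLHS]mulr_natl natrX.
  apply: ler_sum => I; rewrite powersetE => IA.
  have [vI|vI] := boolP (v \in I); last first.
    rewrite big_pred0 => [|B].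
      by rewrite mulr_ge0// sqr_ge0.
    apply/negP => /andP[/andP[BH vB] /eqP ABI].
    by move: vI; rewrite -ABI inE vA vB.
  have Ir : (#|I| <= r)%N by rewrite -(Hr AH) subset_leq_card.
  have I0 : (0 < #|I|)%N by apply/card_gt0P; exists v.
  have k0 : 0 <= x ^+ (r - 1 + (r - #|I|)) by rewrite exprn_ge0.
  apply: (@le_trans _ _ (x ^+ (r - 1 + (r - #|I|)) * wdeg H d I)).
    rewrite /wdeg mulr_sumr big_mkcond [leRHS]big_mkcond/=.
    apply: ler_sum => B _.
    case: ifP => [/andP[/andP[BH vB] /eqP ABI]|_]; last first.
      by case: ifP => // /andP[BH _]; rewrite mulr_ge0// ltW// d0.
    rewrite BH -ABI subsetIr /= mulrC.
    suff -> : #|(A :|: B) :\ v| = (r - 1 + (r - #|I|))%N by rewrite ABI.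
    have := cardsUI A B; rewrite ABI (Hr AH) (Hr BH).
    have := cardsD1 v (A :|: B); rewrite inE vA /= => -> e.
    by move: Ir I0 r0 e; lia.
  apply: (le_trans (ler_wpM2l k0 (degM I vI Ir))).
  rewrite mulrA -exprD -exprM.
  suff -> : (r - 1 + (r - #|I|) + (#|I| - 1) = (r - 1) * 2)%N by [].
  by move: Ir I0 r0; lia.
apply: (@le_trans _ _ (\sum_(A in H | v \in A)
    d A * (2 ^+ r * ((x ^+ (r - 1)) ^+ 2 * M)))).
  apply: ler_sum => A /andP[AH vA].
  rewrite (eq_bigr (fun B => d A * (d B * x ^+ #|(A :|: B) :\ v|))).
    by rewrite -mulr_sumr ler_wpM2l ?inner// ltW// d0.
  by move=> B _; rewrite mulrA.
rewrite -mulr_suml.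
have -> : \sum_(A in H | v \in A) d A = wdeg H d [set v].
  by apply: eq_bigl => A; rewrite sub1set.
have := degM [set v]; rewrite set11 cards1 subnn mul1r => /(_ isT r0) degv.
have c0 : 0 <= 2 ^+ r * ((x ^+ (r - 1)) ^+ 2 * M).
  by rewrite mulr_ge0 ?exprn_ge0// mulr_ge0// sqr_ge0.
apply: (le_trans (ler_wpM2r c0 degv)).
by rewrite le_eqVlt; apply/orP; left; apply/eqP; ring.
Qed.

End Degrees.

(** * The error of the mean-field approximation *)

Lemma weighted_amgm {R : realType} (u s x y : R) : 0 < u -> 0 <= s <= 1 ->
  s * x * y <= u * x ^+ 2 + u^-1 * y ^+ 2.
Proof.
move=> u0 /andP[s0 s1].
rewrite -(ler_pM2l u0) [leRHS]mulrDr mulVKf ?gt_eqF//.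
have F2 : 0 <= (u * x) ^+ 2 + y ^+ 2 by rewrite addr_ge0// sqr_ge0.
have : 0 <= s * (u * x - y) ^+ 2 by rewrite mulr_ge0 ?sqr_ge0.
have : 0 <= (1 - s) * ((u * x) ^+ 2 + y ^+ 2) by rewrite mulr_ge0 ?subr_ge0.
by move: F2; lra.
Qed.

Section MeanFieldError.
Local Set Implicit Arguments.
Local Unset Strict Implicit.
Import mathcomp.boot.fintype mathcomp.boot.finset.
Context {R : realType} {V : finType}.
Variables (p : R) (D : pred {set V}).
Hypothesis p01 : 0 <= p <= 1.
Hypothesis downD : forall Y v, D Y -> D (Y :\ v).
Variables (r : nat) (H : {set {set V}}) (d : {set V} -> R) (W : {set V}).
Hypothesis r0 : (0 < r)%N.
Hypothesis Hr : uniform_hypergraph r H.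
Hypothesis d0 : forall A, A \in H -> 0 < d A.
Hypothesis HW : forall A, A \in H -> [disjoint A & W].
Variables (l M : R).
Hypothesis l01 : 0 < l <= 1.
Hypothesis degM : forall I : {set V}, (0 < #|I| <= r)%N ->
  wdeg H d I <= (l * p) ^+ (#|I| - 1) * M.
Implicit Types (Y Z A B S T : {set V}) (v : V).

Local Notation m := (restricted_mass p D).
Local Notation Z := (\sum_Y m Y).
Local Notation q W' := (fun Y v => vertex_prob m W' v Y).
Local Notation h Y v := (hybrid (q W Y) Y v).

Let m0 Y : 0 <= m Y.
Proof. exact: restricted_mass_ge0. Qed.

Let q0p Y v : 0 <= q W Y v <= p.
Proof. by rewrite vertex_prob_ge0// vertex_prob_le. Qed.

Let h01 Y v a : 0 <= h Y v a <= 1.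
Proof.
apply: hybrid_01 => b; have /andP[-> qp] := q0p Y b; rewrite (le_trans qp)//.
by case/andP: p01.
Qed.

(** The weighted count of the links of [v] that lie in the sample [S], with a
    hybrid product in place of the indicator that the link lies in [Y]. *)
Definition sampled_link S v Y : R :=
  \sum_(A in H | v \in A)
    d A * ((A :\ v \subset S)%:R * \prod_(a in A :\ v) h Y v a).

(** In the expanded square, two edges [A] and [B] survive the sampling and the
    hybrid product with probability at most [(l * p) ^+ #|T|], where [T] is the
    union of their links; it remains to count the pairs. *)
Lemma sampled_link_second_moment v :
  \sum_S rset_mass (fun=> l) S * \sum_Y m Y * sampled_link S v Y ^+ 2 <=
    2 ^+ r * ((l * p) ^+ (r - 1)) ^+ 2 * M ^+ 2 * Z.
Proof.
have [/ltW l0 l1] := andP l01; have [p0 p1] := andP p01.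
have h0 Y a : 0 <= h Y v a by case/andP: (h01 Y v a).
have mS S : 0 <= rset_mass (fun _ : V => l) S.
  by apply: rset_mass_ge0 => ?; rewrite l0.
have sq S Y : sampled_link S v Y ^+ 2 <=
    \sum_(A in H | v \in A) \sum_(B in H | v \in B) d A * d B *
      (((A :|: B) :\ v \subset S)%:R * \prod_(a in (A :|: B) :\ v) h Y v a).
  rewrite expr2 /sampled_link mulr_suml; apply: ler_sum => A /andP[AH vA].
  rewrite mulr_sumr; apply: ler_sum => B /andP[BH vB].
  rewrite mulrACA ler_wpM2l//; first by rewrite mulr_ge0// ltW// d0.
  rewrite mulrACA setDUl subUset -natrM mulnb ler_wpM2l ?ler0n//.
  exact: prod_mul_le_union.
apply: (@le_trans _ _ (\sum_(A in H | v \in A) \sum_(B in H | v \in B)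
    d A * d B * (l * p) ^+ #|(A :|: B) :\ v| * Z)); last first.
  under eq_bigr do rewrite -mulr_suml.
  rewrite -mulr_suml.
  rewrite ler_wpM2r ?sumr_ge0// sum_edge_pairs_le ?mulr_ge0// => I vI Ir.
  by apply: degM; rewrite Ir andbT; apply/card_gt0P; exists v.
apply: (@le_trans _ _ (\sum_S rset_mass (fun=> l) S * \sum_Y m Y *
    \sum_(A in H | v \in A) \sum_(B in H | v \in B) d A * d B *
      (((A :|: B) :\ v \subset S)%:R * \prod_(a in (A :|: B) :\ v) h Y v a))).
  apply: ler_sum => S _; rewrite ler_wpM2l//; apply: ler_sum => Y _.
  by rewrite ler_wpM2l.
under eq_bigr => S _.
  under eq_bigr => Y _.
    rewrite mulr_sumr; under eq_bigr do rewrite mulr_sumr.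
    over.
  rewrite exchange_big/=; under eq_bigr do rewrite exchange_big/=.
  rewrite mulr_sumr; under eq_bigr do rewrite mulr_sumr.
  over.
rewrite exchange_big/=; apply: ler_sum => A /andP[AH vA].
rewrite exchange_big/=; apply: ler_sum => B /andP[BH vB].
set T := (A :|: B) :\ v.
have dAB : 0 <= d A * d B by rewrite mulr_ge0// ltW// d0.
apply: (@le_trans _ _ (\sum_S rset_mass (fun=> l) S *
    (d A * d B * (T \subset S)%:R * (p ^+ #|T| * Z)))).
  apply: ler_sum => S _; rewrite ler_wpM2l//.
  rewrite (eq_bigr (fun Y => d A * d B * (T \subset S)%:R *
    (m Y * \prod_(a in T) h Y v a))); last by move=> Y _; ring.
  rewrite -mulr_sumr ler_wpM2l//; first by rewrite mulr_ge0.
  exact: sum_hybrid_le.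
rewrite (eq_bigr (fun S => (d A * d B * p ^+ #|T| * Z) *
  (if T \subset S then rset_mass (fun=> l) S else 0))); last first.
  by move=> S _; case: ifP => _ /=; ring.
rewrite -mulr_sumr -big_mkcond/= -/(rset_prob _ _) rset_prob_superset.
by rewrite prodr_const exprMn le_eqVlt; apply/orP; left; apply/eqP; ring.
Qed.

(** Once the link of [v] lies in [S], its hybrid product is a function of the
    trace on [W :|: S] without [v], so that the indicator of [v] can be averaged
    over this trace. *)
Lemma edge_error_resample (s : {set V} -> R) S A v : determined_by W s ->
  A \in H -> v \in A -> A :\ v \subset S ->
  \sum_Y m Y * (s Y * (\prod_(a in A :\ v) h Y v a) *
    (q W Y v - (v \in Y)%:R)) =
  \sum_Y m Y * (s Y * (\prod_(a in A :\ v) h Y v a) *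
    (q W Y v - q (W :|: S) Y v)).
Proof.
move=> sW AH vA AS.
have vW : v \notin W by rewrite (disjointFr (HW AH)).
have WS : W \subset (W :|: S) :\ v.
  by rewrite subsetD1 vW andbT subsetUl.
pose g Y := s Y * \prod_(a in A :\ v) h Y v a.
have gdet : determined_by ((W :|: S) :\ v) g.
  move=> Y X YX; rewrite /g (determined_by_subset WS sW YX); congr (_ * _).
  apply: eq_bigr => a aA; rewrite /hybrid; case: ifP => _.
    have aWS : a \in (W :|: S) :\ v.
      have aS := subsetP AS a aA; move: aA.
      by rewrite !inE aS orbT => /andP[->].
    have := congr1 (fun U : {set V} => a \in U) YX.
    by rewrite !(in_setI, aWS, andbT) => ->.
  apply: (determined_by_subset _ (@vertex_prob_determined _ _ m W a) YX).
  exact: subset_trans (subD1set _ _) WS.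
have := vertex_prob_tower m0 gdet => tower.
under eq_bigr do rewrite mulrBr mulrBr.
under [RHS]eq_bigr do rewrite mulrBr mulrBr.
by rewrite !sumrB; congr (_ - _); rewrite -tower.
Qed.

(** The weight [s] singles out the traces on which the error is to be bounded.
    Weighting both sides by the probability [l ^+ (r - 1)] that a sample
    contains a given link introduces the sample; the first term is the cost of
    the motion of the conditional probabilities when [S] is revealed, the second
    one is the second moment of the sampled counts, and [t] balances them. *)
Lemma mean_field_error (s : {set V} -> R) (c t : R) :
  determined_by W s -> (forall Y, 0 <= s Y <= 1) -> 0 < t ->
  (forall S, \sum_v \sum_Y m Y * (q (W :|: S) Y v - q W Y v) ^+ 2 <=
     c * #|S|%:R) ->
  \sum_Y m Y * (s Y * \sum_(A in H)
     d A * (\prod_(a in A) q W Y a - \prod_(a in A) (a \in Y)%:R)) <=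
  t * (c * (#|V|%:R * l)) +
    t^-1 * (#|V|%:R * (2 ^+ r * (p ^+ (r - 1)) ^+ 2 * M ^+ 2 * Z)).
Proof.
move=> sW s01 t0 sat; have [l0 l1] := andP l01.
pose L := l ^+ (r - 1); have L0 : 0 < L by rewrite exprn_gt0.
have mS S : 0 <= rset_mass (fun _ : V => l) S.
  by apply: rset_mass_ge0 => ?; rewrite ltW.
rewrite -(ler_pM2l L0).
have -> : L * \sum_Y m Y * (s Y * \sum_(A in H)
     d A * (\prod_(a in A) q W Y a - \prod_(a in A) (a \in Y)%:R)) =
  \sum_S rset_mass (fun=> l) S * \sum_v \sum_Y m Y *
    (s Y * (q W Y v - q (W :|: S) Y v) * sampled_link S v Y).
  transitivity (\sum_(A in H) \sum_(v in A) d A * (L * \sum_Y m Y *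
      (s Y * (\prod_(a in A :\ v) h Y v a) * (q W Y v - (v \in Y)%:R)))).
    under eq_bigr do rewrite mulr_sumr mulr_sumr.
    rewrite exchange_big/= mulr_sumr; apply: eq_bigr => A AH.
    under eq_bigr do rewrite hybrid_telescope !mulr_sumr.
    rewrite exchange_big/= mulr_sumr; apply: eq_bigr => v vA.
    rewrite mulrCA; congr (_ * _); rewrite mulr_sumr; apply: eq_bigr => Y _.
    by ring.
  transitivity (\sum_(A in H) \sum_(v in A) \sum_S rset_mass (fun=> l) S *
      \sum_Y m Y * (s Y * (q W Y v - q (W :|: S) Y v) *
        (d A * ((A :\ v \subset S)%:R * \prod_(a in A :\ v) h Y v a)))).
    apply: eq_bigr => A AH; apply: eq_bigr => v vA.
    have LE : L = rset_prob (fun=> l) (fun S => A :\ v \subset S).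
      rewrite rset_prob_superset prodr_const; congr (_ ^+ _).
      by have := cardsD1 v A; rewrite vA (Hr AH) => ->; rewrite add1n subn1.
    rewrite LE /rset_prob mulr_suml mulr_sumr big_mkcond/=.
    apply: eq_bigr => S _; case: ifP => AS; last first.
      by rewrite big1 ?mulr0// => Y _; rewrite mul0r !mulr0.
    rewrite (edge_error_resample sW AH vA AS) mulrCA; congr (_ * _).
    by rewrite mulr_sumr; apply: eq_bigr => Y _; rewrite mul1r; ring.
  under eq_bigr do rewrite exchange_big/=.
  rewrite exchange_big/=; apply: eq_bigr => S _.
  rewrite (exchange_big_dep predT)//= mulr_sumr; apply: eq_bigr => v _.
  rewrite -mulr_sumr; congr (_ * _).
  rewrite exchange_big/=; apply: eq_bigr => Y _.
  by rewrite -mulr_sumr -mulr_sumr.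
(* The second moment carries [L ^+ 2] and the energy term no power of [L]; the
   weight [L * t] makes both of them proportional to [L], like the left side. *)
pose u := L * t; have u0 : 0 < u by rewrite mulr_gt0.
have amgm S v Y : s Y * (q W Y v - q (W :|: S) Y v) * sampled_link S v Y <=
    u * (q (W :|: S) Y v - q W Y v) ^+ 2 + u^-1 * sampled_link S v Y ^+ 2.
  rewrite -[X in u * X ^+ 2]opprB sqrrN; exact: weighted_amgm.
apply: (@le_trans _ _ (\sum_S rset_mass (fun=> l) S *
    (u * (c * #|S|%:R) + u^-1 * \sum_v \sum_Y m Y * sampled_link S v Y ^+ 2))).
  apply: ler_sum => S _; rewrite ler_wpM2l//.
  apply: (@le_trans _ _ (u * (\sum_v \sum_Y m Y *
      (q (W :|: S) Y v - q W Y v) ^+ 2) +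
      u^-1 * \sum_v \sum_Y m Y * sampled_link S v Y ^+ 2)).
    rewrite !mulr_sumr -big_split/=; apply: ler_sum => v _.
    rewrite !mulr_sumr -big_split/=; apply: ler_sum => Y _.
    apply: (le_trans (ler_wpM2l (m0 Y) (amgm S v Y))).
    by rewrite le_eqVlt; apply/orP; left; apply/eqP; ring.
  by rewrite lerD2r ler_wpM2l// ltW.
have -> : \sum_S rset_mass (fun=> l) S *
    (u * (c * #|S|%:R) + u^-1 * \sum_v \sum_Y m Y * sampled_link S v Y ^+ 2) =
    u * c * rset_expect (fun=> l) (fun S => #|S|%:R) + u^-1 * \sum_v
      \sum_S rset_mass (fun=> l) S * \sum_Y m Y * sampled_link S v Y ^+ 2.
  rewrite exchange_big/= /rset_expect !mulr_sumr -big_split/=.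
  apply: eq_bigr => S _; rewrite -mulr_sumr; ring.
rewrite rset_expect_card mulrDr lerD//.
  by rewrite le_eqVlt; apply/orP; left; apply/eqP; rewrite /u; ring.
apply: (@le_trans _ _ (u^-1 * \sum_(v : V)
    2 ^+ r * ((l * p) ^+ (r - 1)) ^+ 2 * M ^+ 2 * Z)).
  rewrite ler_wpM2l ?invr_ge0 ?(ltW u0)//; apply: ler_sum => v _.
  exact: sampled_link_second_moment.
rewrite sumr_const -[_ *+ #|V|]mulr_natl exprMn -/L /u.
by rewrite le_eqVlt; apply/orP; left; apply/eqP; field; rewrite !gt_eqF.
Qed.

End MeanFieldError.

(** * The lower tail *)

Section LowerTail.
Local Set Implicit Arguments.
Local Unset Strict Implicit.
Import mathcomp.boot.fintype mathcomp.boot.finset.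
Context {R : realType} {V : finType}.
Variables (r : nat) (H : {set {set V}}) (d : {set V} -> R) (p eps k l eta : R).
Hypothesis r0 : (0 < r)%N.
Hypothesis Hn0 : H != set0.
Hypothesis Hr : uniform_hypergraph r H.
Hypothesis d0 : forall A, A \in H -> 0 < d A.
Hypothesis p01 : 0 < p < 1.
Hypothesis eps0 : 0 < eps.
Hypothesis k0 : 0 < k.
Hypothesis l01 : 0 < l <= 1.
Hypothesis l_small : l * (2 ^+ (r + 5) * k ^+ 3) <= eps ^+ 5.
Hypothesis eta0 : 0 <= eta.
Hypothesis degH : forall s, (1 <= s <= r)%N ->
  max_wdeg s H d <= k * (l * p) ^+ (s - 1) * (edge_weight H d / #|V|%:R).

Implicit Types (W Y : {set V}) (v : V).

Local Notation X := (fun W => edge_weight (induced_hypergraph H W) d).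
Local Notation EX := (rset_expect (fun=> p) X).
Local Notation e := (edge_weight H d).
Local Notation D := (fun Y => X Y <= eta * EX).
Local Notation m := (restricted_mass p D).
Local Notation Z := (\sum_Y m Y).

Let p0 : 0 < p. Proof. by case/andP: p01. Qed.
Let p1 : p < 1. Proof. by case/andP: p01. Qed.
Let p01' : 0 <= p <= 1. Proof. by rewrite !ltW. Qed.

Lemma edge_weight_gt0 : 0 < e.
Proof.
have [A AH] := set0Pn _ Hn0; rewrite /edge_weight (bigD1 A)//=.
by rewrite ltr_wpDr ?d0// sumr_ge0// => B /andP[BH _]; rewrite ltW// d0.
Qed.

Lemma card_vertices_gt0 : 0 < #|V|%:R :> R.
Proof.
have [A AH] := set0Pn _ Hn0; rewrite ltr0n (leq_trans r0)// -(Hr AH).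
exact: max_card.
Qed.

Lemma expect_edge_weight : EX = p ^+ r * e.
Proof.
rewrite rset_expect_edge_weight /edge_weight mulr_sumr; apply: eq_bigr => A AH.
by rewrite prodr_const (Hr AH) mulrC.
Qed.

Let EX0 : 0 < EX.
Proof. by rewrite expect_edge_weight mulr_gt0 ?exprn_gt0// edge_weight_gt0. Qed.

Lemma edge_weight_down Y v : D Y -> D (Y :\ v).
Proof.
apply: le_trans; rewrite /edge_weight big_mkcond [leRHS]big_mkcond/=.
apply: ler_sum => A _; rewrite !inE; case AH : (A \in H) => //=.
case: ifP => [AY|_]; last by case: ifP => // _; rewrite ltW// d0.
by rewrite (subset_trans AY (subD1set _ _)).
Qed.

Lemma tail_mass_gt0 : 0 < Z.
Proof.
(* The empty set spans no edge, since [r] is positive. *)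
rewrite (bigD1 set0)//= ltr_wpDr//.
  by apply: sumr_ge0 => Y _; exact: restricted_mass_ge0.
rewrite /restricted_mass mulr_gt0//; last first.
  by rewrite rset_massE prodr_gt0// => v _; rewrite inE subr_gt0.
rewrite ltr0n lt0b /edge_weight big_pred0 ?mulr_ge0 ?(ltW EX0)// => A.
rewrite inE subset0; apply/negP => /andP[/Hr + /eqP A0].
by rewrite A0 cards0 => r00; move: r0; rewrite -r00.
Qed.

(** Half of the slack [eps] absorbs the edges meeting [W], whose weight is at
    most [#|W|] times the maximum degree. *)
Lemma mean_field_feasible W Y : #|W|%:R * (2 * k) <= eps * #|V|%:R ->
  \sum_(A in H | [disjoint A & W])
    d A * \prod_(a in A) vertex_prob m W a Y <= (eta + eps / 2) * EX ->
  Phi_feasible H d p (eta + eps) (mean_field p D W Y).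
Proof.
move=> Wsmall good; have n0 := card_vertices_gt0.
have q0p v : 0 <= mean_field p D W Y v <= p.
  rewrite /mean_field; case: ifP => _; first by rewrite lexx ltW.
  rewrite vertex_prob_ge0 ?vertex_prob_le//; first exact: edge_weight_down.
  by move=> ?; exact: restricted_mass_ge0.
split=> [v|].
  by have /andP[-> qp] := q0p v; rewrite (le_trans qp)// ltW.
rewrite [leLHS]rset_expect_edge_weight.
rewrite (bigID (fun A : {set V} => [disjoint A & W]))/=.
have -> : (eta + eps) * EX = (eta + eps / 2) * EX + eps / 2 * EX by field.
rewrite lerD//.
  apply: le_trans good; rewrite le_eqVlt; apply/orP; left; apply/eqP.
  apply: eq_bigr => A /andP[AH AW]; congr (_ * _); apply: eq_bigr => a aA.
  by rewrite /mean_field (disjointFr AW).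
apply: (@le_trans _ _ (p ^+ r * \sum_(v in W) wdeg H d [set v])).
  apply: (@le_trans _ _ (\sum_(A in H | ~~ [disjoint A & W]) p ^+ r * d A)).
    apply: ler_sum => A /andP[AH _]; rewrite mulrC ler_wpM2r ?(ltW (d0 AH))//.
    by rewrite -(Hr AH) -prodr_const; apply: ler_prod => a _.
  by rewrite -mulr_sumr ler_wpM2l ?exprn_ge0 ?(ltW p0)// weight_meeting_le.
have degW : \sum_(v in W) wdeg H d [set v] <= #|W|%:R * (k * (e / #|V|%:R)).
  rewrite mulr_natl -sumr_const; apply: ler_sum => v _.
  apply: (le_trans (wdeg_le_max _ _ _)); rewrite cards1.
  by have := @degH 1; rewrite expr0 mulr1; apply; rewrite r0.
rewrite expect_edge_weight mulrCA ler_wpM2l ?exprn_ge0 ?(ltW p0)//.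
apply: (le_trans degW).
have -> : #|W|%:R * (k * (e / #|V|%:R)) =
    #|W|%:R * (2 * k) * (e / (2 * #|V|%:R)) by field; rewrite gt_eqF.
have -> : eps / 2 * e = eps * #|V|%:R * (e / (2 * #|V|%:R)).
  by field; rewrite gt_eqF.
by rewrite ler_wpM2r// divr_ge0 ?(ltW edge_weight_gt0)// mulr_ge0 ?ltW.
Qed.

(** Traces that are not bad give admissible product measures, whose divergence
    is at least [Phi]; the others have nonnegative divergence and carry at most
    a proportion [eps] of the mass. *)
Lemma entropy_ge_Phi : (1 - eps) * Phi H d p (eta + eps) <= - ln Z.
Proof.
have n0 := card_vertices_gt0; have e0 := edge_weight_gt0.
have Z0 := tail_mass_gt0; have down := edge_weight_down.
have [l0 l1] := andP l01.
have m0 Y : 0 <= m Y by exact: restricted_mass_ge0.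
(* With this penalty the saturated set has density at most [eps / (2 * k)]. *)
pose c := p ^+ 2 * Z * (2 * k) / eps.
have c0 : 0 < c by rewrite divr_gt0// !mulr_gt0// exprn_gt0.
have [W [Wc sat]] := exists_saturated_set p01 down (ltW c0).
have Wsmall : #|W|%:R * (2 * k) <= eps * #|V|%:R.
  have pZ : 0 < p ^+ 2 * Z / eps by rewrite divr_gt0// mulr_gt0// exprn_gt0.
  rewrite -(ler_pM2l pZ).
  have -> : p ^+ 2 * Z / eps * (#|W|%:R * (2 * k)) = c * #|W|%:R.
    by rewrite /c; ring.
  have -> : p ^+ 2 * Z / eps * (eps * #|V|%:R) = #|V|%:R * (p ^+ 2 * Z).
    by field; rewrite gt_eqF.
  exact: Wc.
pose q Y v := vertex_prob m W v Y.
pose H' := [set A in H | [disjoint A & W]].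
have H'H A : A \in H' -> A \in H by rewrite inE => /andP[].
pose S Y := \sum_(A in H') d A * \prod_(a in A) q Y a.
pose bad Y := (eta + eps / 2) * EX < S Y.
have badE : \sum_Y m Y * (bad Y)%:R <= eps * Z.
  have det : determined_by W (fun Y => (bad Y)%:R : R).
    move=> Y Y' YY'; suff -> : bad Y = bad Y' by [].
    rewrite /bad; congr (_ < _); apply: eq_bigr => A _; congr (_ * _).
    apply: eq_bigr => a _.
    apply: (determined_by_subset _ (@vertex_prob_determined _ _ m W a) YY').
    exact: subD1set.
  have Hr' : uniform_hypergraph r H' by move=> A /H'H; exact: Hr.
  have d0' A : A \in H' -> 0 < d A by move/H'H; exact: d0.
  have HW' A : A \in H' -> [disjoint A & W] by rewrite inE => /andP[].
  pose M := k * (e / #|V|%:R).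
  have degM (I : {set V}) : (0 < #|I| <= r)%N ->
      wdeg H' d I <= (l * p) ^+ (#|I| - 1) * M.
    move=> Ir; apply: (@le_trans _ _ (wdeg H d I)).
      rewrite /wdeg big_mkcond [leRHS]big_mkcond/=; apply: ler_sum => A _.
      rewrite inE; case AH : (A \in H) => //=; have := ltW (d0 AH).
      by case: [disjoint A & W] => //=; case: ifP.
    apply: (le_trans (wdeg_le_max _ _ _)); apply: (le_trans (degH Ir)).
    by rewrite /M [leRHS]mulrCA [leRHS]mulrA.
  have [P P0 PE] : exists2 P, 0 < P & P = p ^+ (r - 1).
    by exists (p ^+ (r - 1)); rewrite ?exprn_gt0.
  have [B B0 BE] : exists2 B : R, 0 < B & B = 2 ^+ r.
    by exists (2 ^+ r); rewrite ?exprn_gt0.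
  (* Makes the second moment term equal to [eps ^+ 2 / 4 * EX * Z]; the
     smallness of [l] then gives the same bound for the other one. *)
  pose t := 4 * B * k ^+ 2 / eps ^+ 2 * (P * e / (#|V|%:R * p)).
  have t0 : 0 < t.
    by rewrite mulr_gt0 ?divr_gt0 ?mulr_gt0 ?exprn_gt0.
  have b01 Y : 0 <= ((bad Y)%:R : R) <= 1.
    by case: (bad Y); rewrite ?lexx ?ler01.
  have := mean_field_error p01' down r0 Hr' d0' HW' l01 degM det b01 t0 sat.
  set err := (X in X <= _); rewrite -PE -BE => errle.
  have EXE : EX = p * P * e.
    by rewrite expect_edge_weight PE -exprS -addn1 subnK.
  (* On a bad trace the error exceeds [eps / 2 * EX], as [X Y <= eta * EX]. *)
  have lo : eps / 2 * EX * \sum_Y m Y * (bad Y)%:R <= err.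
    rewrite mulr_sumr; apply: ler_sum => Y _; rewrite mulrCA.
    have [DY|DY] := boolP (D Y); last first.
      by rewrite /restricted_mass (negbTE DY) !mul0r.
    rewrite ler_wpM2l//.
    have [bY|_] := boolP (bad Y); last by rewrite mulr0 mul0r.
    rewrite mulr1 mul1r; under eq_bigr do rewrite mulrBr.
    rewrite sumrB -/(S Y).
    have XY : \sum_(A in H') d A * \prod_(a in A) (a \in Y)%:R <= X Y.
      rewrite /edge_weight big_mkcond [leRHS]big_mkcond/=.
      apply: ler_sum => A _; rewrite !inE; case AH : (A \in H) => //=.
      have [AY|/subsetPn[a aA aY]] := boolP (A \subset Y).
        rewrite big1; last by move=> a aA; rewrite (subsetP AY _ aA).
        by case: ifP => _; rewrite ?mulr1// ltW// d0.
      by rewrite (bigD1 a)//= (negbTE aY) mul0r mulr0; case: ifP.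
    move: (le_trans XY DY) bY; rewrite /bad => h1 h2; lra.
  have hi : err <= eps ^+ 2 / 2 * EX * Z.
    apply: (le_trans errle).
    have -> : t^-1 * (#|V|%:R * (B * P ^+ 2 * M ^+ 2 * Z)) =
        eps ^+ 2 / 4 * EX * Z.
      rewrite /t /M; move: Z => z; rewrite EXE.
      by field; rewrite !gt_eqF.
    have -> : t * (c * (#|V|%:R * l)) =
        (l * (2 ^+ (r + 5) * k ^+ 3)) * (EX * Z / (4 * eps ^+ 3)).
      rewrite /t /c exprD -BE; move: Z => z; rewrite EXE.
      by field; rewrite !gt_eqF.
    have -> : eps ^+ 2 / 2 * EX * Z =
        eps ^+ 5 * (EX * Z / (4 * eps ^+ 3)) + eps ^+ 2 / 4 * EX * Z.
      by field; rewrite gt_eqF.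
    rewrite lerD2r ler_wpM2r// divr_ge0// ?mulr_ge0 ?exprn_ge0// ltW//.
  have E0 : 0 < eps / 2 * EX by rewrite mulr_gt0// divr_gt0.
  rewrite -(ler_pM2l E0); apply: (le_trans lo); apply: (le_trans hi).
  by rewrite le_eqVlt; apply/orP; left; apply/eqP; ring.
set Ph := Phi H d p (eta + eps).
have F0 : classical_sets.nonempty (Phi_feasible H d p (eta + eps)).
  apply: Phi_feasible_neq0 => //; last by rewrite addr_ge0// ltW.
  apply/negP => /Hr; rewrite cards0 => r00; move: r0.
  by rewrite -r00.
have [x [x01 _] [PhE Phle]] := PhiP p01 F0.
have Ph0 : 0 <= Ph.
  rewrite /Ph PhE sumr_ge0// => v _; exact: bernoulli_KL_ge0.
have ent := sum_bernoulli_KL_le_entropy p01 down W Z0.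
have entlo : (Z - \sum_Y m Y * (bad Y)%:R) * Ph <=
    \sum_Y m Y * \sum_v bernoulli_KL p (mean_field p D W Y v).
  rewrite -sumrB mulr_suml; apply: ler_sum => Y _.
  have q01 v : 0 <= mean_field p D W Y v <= 1.
    rewrite /mean_field; case: ifP => _; first by rewrite !ltW.
    rewrite vertex_prob_ge0//= (le_trans (vertex_prob_le _ _ _ _ _))//.
    exact: ltW.
  have [bY|bY] := boolP (bad Y).
    rewrite mulr1 subrr mul0r mulr_ge0// sumr_ge0// => v _.
    exact: bernoulli_KL_ge0.
  rewrite mulr0 subr0 ler_wpM2l//; apply: Phle.
  apply: mean_field_feasible => //.
  move: bY; rewrite /bad -leNgt /S => bY; apply: le_trans bY.
  rewrite le_eqVlt; apply/orP; left; apply/eqP.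
  by apply: eq_bigl => A; rewrite inE.
rewrite -(ler_pM2l Z0); apply: le_trans ent; apply: le_trans entlo.
rewrite mulrA ler_wpM2r// mulrBr mulr1 lerD2l lerN2 [leRHS]mulrC.
exact: badE.
Qed.

End LowerTail.

Theorem theorem5 (R : realType) (r : nat) (p0 eps K : R) :
  (0 < r)%N -> p0 < 1 -> 0 < eps ->
  exists lambda C : R, 0 < lambda /\
    forall (V : finType) (H : {set {set V}}) (d : {set V} -> R) (p : R),
      H != finset.set0 ->
      uniform_hypergraph r H ->
      (forall A : {set V}, A \in H -> 0 < d A) ->
      0 < p <= p0 ->
      (forall s : nat, (1 <= s <= r)%N ->
         max_wdeg s H d
           <= K * (lambda * p) ^+ (s - 1) * (edge_weight H d / #|V|%:R)) ->
      let X (W : {set V}) : R := edge_weight (induced_hypergraph H W) d in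
      let EX : R := rset_expect (fun=> p) X in
      forall eta : R, 0 <= eta ->
        (1 - eps) * Phi H d p (eta + eps) - C
          <= - ln (rset_prob (fun=> p) (fun W => X W <= eta * EX)).
Proof.
move=> r0 p01 eps0; pose k := Num.max 1 K.
have k0 : 0 < k by rewrite lt_max ltr01.
pose b := 2 ^+ (r + 5) * k ^+ 3.
have b0 : 0 < b by rewrite mulr_gt0 ?exprn_gt0.
pose l := Num.min 1 (eps ^+ 5 / b).
have l0 : 0 < l by rewrite lt_min ltr01 divr_gt0// exprn_gt0.
exists l, 0; split=> // V H d p Hn0 Hr d0 /andP[pp0 pp] degH X EX eta eta0.
have l01 : 0 < l <= 1 by rewrite l0 ge_min lexx.
have lb : l * b <= eps ^+ 5 by rewrite -ler_pdivlMr// ge_min lexx orbT.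
have pp1 : 0 < p < 1 by rewrite pp0 (le_lt_trans pp).
have degk s : (1 <= s <= r)%N ->
    max_wdeg s H d <= k * (l * p) ^+ (s - 1) * (edge_weight H d / #|V|%:R).
  move=> sr; apply: (le_trans (degH s sr)); rewrite -!mulrA ler_wpM2r//.
    rewrite mulr_ge0 ?exprn_ge0 ?mulr_ge0 ?(ltW l0) ?(ltW pp0) ?divr_ge0//.
    by rewrite sumr_ge0// => A /d0/ltW.
  by rewrite le_max lexx orbT.
rewrite subr0.
have := entropy_ge_Phi r0 Hn0 Hr d0 pp1 eps0 k0 l01 lb eta0 degk.
by rewrite (restricted_massE _ _ predT).
Qed.
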